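(* (Decomposition lemma.) There is an algorithm that, given a consistent instance $(A,B)$, computes in time $O(|B|^3)$ a list of $k\leq |B|$ basic instances $(A_1,B_1),\dots,(A_k,B_k)$ and positive integers $p_1,\dots,p_k$ such that: (i) $|A_i|=|A|$ for all $1\le i\le k$; (ii) $\operatorname{lcm} L(A_i)$ divides $\operatorname{lcm} L(A)$ for all $1\le i\le k$; (iii) $|B_1|+\cdots+|B_k|\leq |B|$; (iv) $\mathrm{Sol}(A,B)=(\mathrm{Sol}(A_1,B_1)\otimes p_1)+\cdots +(\mathrm{Sol}(A_k,B_k)\otimes p_k)$.
   Context: A sum of cycles is a finite digraph that is a disjoint union of directed cycles, considered up to isomorphism. $C_\ell$ is the directed cycle of length $\ell$, $A(\ell)$ is the number of cycles of length $\ell$ in $A$, $|A|=\sum_{\ell\ge1}\ell A(\ell)$ is the number of vertices, and $L(A)=\{\ell : A(\ell)>0\}$. $A+B$ is disjoint union, and $AB$ is the direct product of digraphs, i.e. the distributive product with $C_aC_b=\gcd(a,b)\,C_{\operatorname{lcm}(a,b)}$ ($nC_\ell$ denotes $n$ disjoint copies of $C_\ell$). An instance is a pair $(A,B)$ of non-empty sums of cycles; $\mathrm{Sol}(A,B)$ is the set of sums of cycles $X$ with $AX=B$. For sets of positive integers, $N\lor M=\{\operatorname{lcm}(n,m): n\in N,m\in M\}$ and $N\lor x=N\lor\{x\}$. The support $L(A,B)$ of an instance is the set of positive integers $x\le |B|/|A|$ such that $L(A)\lor x\subseteq L(B)$. The instance is consistent if $L(A)\lor L(A,B)=L(B)$,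 and basic if every element of $L(B)$ divides $\operatorname{lcm}L(A)$. For a positive integer $p$, $A\otimes p$ is the sum of cycles obtained from $A$ by multiplying the length of every cycle by $p$. For sets $\boldsymbol A,\boldsymbol B$ of sums of cycles, $\boldsymbol A+\boldsymbol B=\{A+B: A\in\boldsymbol A,B\in\boldsymbol B\}$ and $\boldsymbol A\otimes p=\{A\otimes p: A\in\boldsymbol A\}$. *)

(* Defs.v *)
From mathcomp Require Import all_boot finmap multiset.
From mathcomp Require Import classical_sets.

Set Implicit Arguments.
Unset Strict Implicit.
Unset Printing Implicit Defensive.

(** MathComp world.

   A sum of cycles, up to isomorphism, is a finite multiset [A : {mset nat}] of
   positive integers, the lengths of its cycles: [A l] is the number of cycles
   of length [l], and iterating over [A] visits each length with its
   multiplicity. *)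

Local Open Scope mset_scope.
Local Open Scope nat_scope.

Definition is_soc (A : {mset nat}) : Prop := 0 \notin A.

Definition soc_size (A : {mset nat}) : nat := \sum_(l <- finsupp A) l * A l.

Definition lengths (A : {mset nat}) : {fset nat} := finsupp A.

Definition soc_mul (A B : {mset nat}) : {mset nat} :=
  \big[msetD/mset0]_(a <- A) \big[msetD/mset0]_(b <- B)
    msetn (gcdn a b) (lcmn a b).

Definition soc_scale (A : {mset nat}) (p : nat) : {mset nat} :=
  \big[msetD/mset0]_(a <- A) [mset a * p].

Definition lcm_set (N : {fset nat}) : nat := \big[lcmn/1]_(n <- N) n.

Definition lcm_join (N M : {fset nat}) : {fset nat} :=
  [fset lcmn n m | n in N, m in M]%fset.

Definition is_instance (A B : {mset nat}) : Prop :=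
  [/\ is_soc A, is_soc B, A <> mset0 & B <> mset0].

Definition Sol (A B : {mset nat}) : set {mset nat} :=
  [set X | is_soc X /\ soc_mul A X = B]%classic.

Definition instance_support (A B : {mset nat}) : {fset nat} :=
  [fset x in iota 1 (soc_size B %/ soc_size A)
     | (lcm_join (lengths A) [fset x] `<=` lengths B)]%fset.

Definition consistent (A B : {mset nat}) : Prop :=
  lcm_join (lengths A) (instance_support A B) = lengths B.

Definition basic (A B : {mset nat}) : Prop :=
  forall l, l \in lengths B -> l %| lcm_set (lengths A).

Definition set_add (S T : set {mset nat}) : set {mset nat} :=
  [set msetD X Y | X in S & Y in T]%classic.

Definition set_scale (S : set {mset nat}) (p : nat) : set {mset nat} :=
  [set soc_scale X p | X in S]%classic.

(** Model of computation: a word RAM. A program is a structured command over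
   registers and one memory, both indexed by [nat]. Each node of an expression
   and each executed assignment or test costs one unit of time. All operations
   are on words, i.e. numbers [<= W]: a computation in which some constant,
   address or intermediate result exceeds [W] is stuck. Unit-cost arithmetic is
   realistic as long as [W] is polynomial in the size of the input. *)

Inductive binop := Add | Sub | Mul | Div | Mod.

Inductive expr :=
| Cst of nat
| Reg of nat
| Mem of expr
| Bin of binop & expr & expr.

Inductive cmd :=
| Skip
| SetReg of nat & expr
| SetMem of expr & expr
| Seq of cmd & cmd
| If of expr & cmd & cmd
| While of expr & cmd.

Record state := State { reg : nat -> nat; mem : nat -> nat }.

Definition update (f : nat -> nat) (i v : nat) : nat -> nat :=
  fun j => if j == i then v else f j.

(* [Sub] is truncated at 0. *)
Definition eval_op (o : binop) : nat -> nat -> nat :=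
  match o with
  | Add => addn | Sub => subn | Mul => muln | Div => divn | Mod => modn
  end.

Definition word (W v : nat) : option nat := if v <= W then Some v else None.

Fixpoint eval (W : nat) (s : state) (e : expr) : option nat :=
  match e with
  | Cst n => word W n
  | Reg x => word W (reg s x)
  | Mem a => if eval W s a is Some i then word W (mem s i) else None
  | Bin o e1 e2 =>
      match eval W s e1, eval W s e2 with
      | Some v1, Some v2 => word W (eval_op o v1 v2)
      | _, _ => None
      end
  end.

Fixpoint cost (e : expr) : nat :=
  match e with
  | Cst _ | Reg _ => 1
  | Mem a => (cost a).+1
  | Bin _ e1 e2 => (cost e1 + cost e2).+1
  end.

(* [exec W p s t s']: with words bounded by [W], the command [p] started in [s]
   halts in [s'] after exactly [t] units of time; tests are true when nonzero. *)
Inductive exec (W : nat) : cmd -> state -> nat -> state -> Prop :=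
| ExecSkip s : exec W Skip s 1 s
| ExecSetReg s x e v :
    eval W s e = Some v ->
    exec W (SetReg x e) s (cost e).+1 (State (update (reg s) x v) (mem s))
| ExecSetMem s a e i v :
    eval W s a = Some i -> eval W s e = Some v ->
    exec W (SetMem a e) s (cost a + cost e).+1
      (State (reg s) (update (mem s) i v))
| ExecSeq p q s s' s'' t t' :
    exec W p s t s' -> exec W q s' t' s'' -> exec W (Seq p q) s (t + t') s''
| ExecIfTrue e p q s s' v t :
    eval W s e = Some v -> v != 0 -> exec W p s t s' ->
    exec W (If e p q) s ((cost e).+1 + t) s'
| ExecIfFalse e p q s s' t :
    eval W s e = Some 0 -> exec W q s t s' ->
    exec W (If e p q) s ((cost e).+1 + t) s'
| ExecWhileTrue e p s s' s'' v t t' :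
    eval W s e = Some v -> v != 0 -> exec W p s t s' ->
    exec W (While e p) s' t' s'' ->
    exec W (While e p) s ((cost e).+1 + t + t') s''
| ExecWhileFalse e p s :
    eval W s e = Some 0 -> exec W (While e p) s (cost e).+1 s.

Definition load (inp : seq nat) : state := State (fun=> 0) (nth 0 inp).

(* The output is stored contiguously from the address held in register 0. *)
Definition returns (s : state) (out : seq nat) : Prop :=
  forall j, j < size out -> mem s (reg s 0 + j) = nth 0 out j.

(* The words of [prog] on the input [inp] are bounded by [W], and it outputs
   [out] within [T] units of time. *)
Definition computes (W : nat) (prog : cmd) (inp out : seq nat) (T : nat) : Prop :=
  exists t s, [/\ exec W prog (load inp) t s, t <= T & returns s out].

(* A sum of cycles is presented by |A|, A(1), ..., A(|A|). *)
Definition encode_soc (A : {mset nat}) : seq nat :=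
  soc_size A :: [seq A l | l <- iota 1 (soc_size A)].

Definition encode_instance (A B : {mset nat}) : seq nat :=
  encode_soc A ++ encode_soc B.

(* The list of triples ((A_i, B_i), p_i), preceded by its length. *)
Definition encode_list (D : seq ({mset nat} * {mset nat} * nat)) : seq nat :=
  size D :: flatten [seq d.2 :: encode_instance d.1.1 d.1.2 | d <- D].

(* Main.v *)
From HB Require Import structures.
Require Import Defs.
From mathcomp Require Import all_boot finmap multiset zify.
From mathcomp Require Import classical_sets.

Local Open Scope mset_scope.
Local Open Scope nat_scope.

(** Let m_p be the largest exponent of the prime p in an element of L(A).  Call
   excess of b the product of the full powers p^(v_p(b)) over the primes p with
   v_p(b) > m_p.  When a is in L(A), the lcm of a and x has the same excess as
   x: at a prime of the excess, x dominates every a, and at any other prime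
   the exponent of the lcm stays at most m_p.  Hence the equation AX = B splits
   along the excess: the cycles of X of excess q produce exactly the cycles of B
   of excess q.

   Fix an excess q.  A length of excess q is q * x' with x' coprime to q, and x'
   divides lcm L(A) with the primes of q removed.  For a in L(A),
   gcd(a, q x') = gcd(a, q) gcd(a', x') and lcm(a, q x') = q lcm(a', x') where
   a' = a / gcd(a, q).  So the part of excess q of the equation is the q-fold
   dilation of A_q X' = B_q, where A_q replaces each cycle of length a by
   gcd(a, q) cycles of length a' ([quotient]), and B_q collects the b / q
   for the lengths b of excess q ([block]).  A_q has as many vertices as A, and
   (A_q, B_q) is basic: no prime of q is left on either side, and at any other
   prime p the exponents in B_q are at most m_p, which A_q attains.  This is
   [Sol_decomposition], which rests on [excess_lcm] and [soc_mul_scale].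

   The excesses must be found without computing lcm L(A), which may be
   exponentially large.  With r the gcd of the numbers b / gcd(b, a) for a in
   L(A), the primes of r are those of the excess of b, so that the excess is
   gcd(b, r^b) ([excessE]), reached by b steps t := gcd(b, t * r).  The program
   tabulates the excess of all b <= |B|, then for each q <= |B| writes the
   candidate record of q behind the records already kept, and keeps it when
   its second component is non-empty.  Both components of a record are images
   of a multiset under a weighted map of lengths ([wimage]), so that one loop
   ([scatter]) writes them both.  Euclid's algorithm is only charged linear
   time; the nested loops then cost O(|B|^3), since consistency forces
   |A| <= |B|.

   Programs are handled by weakest preconditions that hand the elapsed time over
   to the postcondition ([wp]). *)

(* From here on, [mem] and [Mem] denote the memory of the machine, not membership. *)
Import Defs.

(** * The excess of a length *)

Definition excess_primes (A : seq nat) (b : nat) : nat_pred :=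
  [pred p | all (fun a => logn p a < logn p b) A].

Definition excess (A : seq nat) (b : nat) : nat := b`_(excess_primes A b).

(** All that multiplication by A needs to know of an excess q. *)
Definition dominates (q : nat) (A : seq nat) :=
  forall p a, p \in primes q -> a \in A -> logn p a < logn p q.

Lemma logn_partn (pi : nat_pred) p n :
  logn p n`_pi = if p \in pi then logn p n else 0.
Proof.
have E : logn p n`_pi = logn p n`_[predI pi & (p : nat_pred)].
  by rewrite partnI logn_part.
rewrite {}E; case: ifP => ppi.
  rewrite -[RHS]logn_part; congr (logn p _); apply: eq_partn => l.
  by rewrite !inE /=; case: eqP => [->|]; rewrite ?andbF // ppi.
rewrite (@eq_partn _ pred0) ?(@eq_partn _ pred0 n).
  have -> : n`_pred0 = 1 by rewrite /partn big_pred0.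
  by rewrite logn1.
by move=> l; rewrite !inE /=; case: eqP => [->|]; rewrite ?andbF // ppi.
Qed.

Lemma excess_gt0 A b : 0 < excess A b. Proof. exact: part_gt0. Qed.

Lemma excess_dvd A b : excess A b %| b. Proof. exact: dvdn_part. Qed.

Lemma coprime_excess A b : 0 < b -> coprime (excess A b) (b %/ excess A b).
Proof.
move=> b0; rewrite /excess -{3}(partnC (excess_primes A b) b0) mulKn ?part_gt0//.
exact: coprime_partC.
Qed.

Lemma excess_dominates A b : dominates (excess A b) A.
Proof.
move=> p a; rewrite -logn_gt0 /excess logn_partn; case: ifP => // /allP H _ aA.
exact: H.
Qed.

(** The prime p survives in every b / gcd(b, a) exactly when b has more factors p
   than each a. *)
Lemma logn_biggcd p b (A : seq nat) : 0 < b -> (forall a, a \in A -> 0 < a) ->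
  (0 < logn p (\big[gcdn/b]_(a <- A) (b %/ gcdn b a))) =
  (0 < logn p b) && all (fun a => logn p a < logn p b) A.
Proof.
move=> b0; elim: A => [|a A IH] A0; first by rewrite big_nil andbT.
have a0 : 0 < a by apply: A0; rewrite inE eqxx.
have IH' : _ := IH (fun x xA => A0 x (@mem_behead _ (a :: A) x xA)).
rewrite big_cons logn_gcd; first last.
- by elim/big_ind: _ => // [x y x0 y0|i _];
    rewrite ?gcdn_gt0 ?x0 // divn_gt0 ?gcdn_gt0 ?b0 // dvdn_leq // dvdn_gcdl.
- by rewrite divn_gt0 ?gcdn_gt0 ?b0 // dvdn_leq // dvdn_gcdl.
rewrite logn_div ?dvdn_gcdl // logn_gcd // leq_min IH' /= subn_gt0 gtn_min ltnn /=.
by case: (0 < _); rewrite ?andbF.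
Qed.

(** Raising to the power b saturates the exponents, because v_p(b) < b: the gcd
   with b then has the full exponent of b at the primes of the base and
   none at the others. *)
Lemma excessE (A : seq nat) b : 0 < b -> (forall a, a \in A -> 0 < a) ->
  gcdn b ((\big[gcdn/b]_(a <- A) (b %/ gcdn b a)) ^ b) = excess A b.
Proof.
move=> b0 A0; set r := \big[_/_]_(_ <- _) _.
have r0 : 0 < r.
  by rewrite /r; elim/big_ind: _ => // [x y x0 y0|i _];
    rewrite ?gcdn_gt0 ?x0 // divn_gt0 ?gcdn_gt0 ?b0 // dvdn_leq // dvdn_gcdl.
apply: eqn_from_log; rewrite ?gcdn_gt0 ?b0 ?excess_gt0 // => p.
rewrite /excess logn_partn logn_gcd ?expn_gt0 ?r0 // lognX inE.
have := logn_biggcd p b A b0 A0; rewrite -/r.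
case: (ltnP 0 (logn p b)) => /= [pb <-|]; last first.
  by rewrite leqn0 => /eqP -> _; rewrite min0n if_same.
case: (ltnP 0 (logn p r)) => [pr|]; last by rewrite leqn0 => /eqP ->; rewrite muln0 minn0.
apply/minn_idPl; apply: leq_trans (leq_pmulr _ pr).
exact/ltnW/ltn_logl.
Qed.

(** Where the lcm exceeds every element of A it exceeds a, so its exponent is
   that of x. *)
Lemma excess_lcm (A : seq nat) a x : 0 < x -> (forall a, a \in A -> 0 < a) ->
  a \in A -> excess A (lcmn a x) = excess A x.
Proof.
move=> x0 A0 aA; have a0 := A0 _ aA.
apply: eqn_from_log; rewrite ?excess_gt0 // => p.
rewrite /excess !logn_partn logn_lcm // !inE.
have -> : all (fun a0 => logn p a0 < logn p (lcmn a x)) A =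
          all (fun a0 => logn p a0 < logn p x) A.
  rewrite logn_lcm //; case: (leqP (logn p a) (logn p x)) => [h|h].
    by [].
  apply/idP/idP => /allP/(_ _ aA) /=; first by rewrite ltnn.
  by rewrite ltnNge (ltnW h).
by case: ifP => // /allP/(_ _ aA) /= /ltnW /maxn_idPr.
Qed.

Lemma coprime_logn p m n : coprime m n -> 0 < logn p m -> logn p n = 0.
Proof.
move=> cop; rewrite logn_gt0 mem_primes => /and3P[pr _ pm].
by rewrite logn_coprime // (coprime_dvdl pm).
Qed.

Lemma cofactor_gt0 a q : 0 < a -> 0 < a %/ gcdn a q.
Proof. by move=> a0; rewrite divn_gt0 ?gcdn_gt0 ?a0 // dvdn_leq // dvdn_gcdl. Qed.

(** At each prime either x or q is trivial; where q is not, domination makes q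
   absorb all of a, so that a / gcd(a, q) is trivial there. *)
Lemma gcd_scale q (A : seq nat) a x : dominates q A -> a \in A -> coprime x q ->
  0 < a -> 0 < x -> 0 < q ->
  gcdn a (x * q) = gcdn a q * gcdn (a %/ gcdn a q) x.
Proof.
move=> dom aA cop a0 x0 q0; have c0 := cofactor_gt0 a q a0.
apply: eqn_from_log; rewrite ?muln_gt0 ?gcdn_gt0 ?a0 ?c0 // => p.
rewrite lognM ?gcdn_gt0 ?a0 ?c0 // !logn_gcd ?muln_gt0 ?x0 // lognM //.
rewrite logn_div ?dvdn_gcdl // logn_gcd //.
have [qp|] := posnP (logn p q); first by rewrite qp; lia.
by move=> qp; move: (qp); rewrite logn_gt0 => /dom/(_ aA);
  rewrite (@coprime_logn p q x) // 1?coprime_sym //; lia.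
Qed.

Lemma lcm_scale q (A : seq nat) a x : dominates q A -> a \in A -> coprime x q ->
  0 < a -> 0 < x -> 0 < q ->
  lcmn a (x * q) = lcmn (a %/ gcdn a q) x * q.
Proof.
move=> dom aA cop a0 x0 q0; have c0 := cofactor_gt0 a q a0.
apply: eqn_from_log; rewrite ?lcmn_gt0 ?muln_gt0 ?lcmn_gt0 ?a0 ?c0 ?x0 // => p.
rewrite lognM ?lcmn_gt0 ?a0 ?c0 ?x0 // !logn_lcm ?muln_gt0 ?x0 // lognM //.
rewrite logn_div ?dvdn_gcdl // logn_gcd //.
have [qp|] := posnP (logn p q); first by rewrite qp; lia.
by move=> qp; move: (qp); rewrite logn_gt0 => /dom/(_ aA);
  rewrite (@coprime_logn p q x) // 1?coprime_sym //; lia.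
Qed.

(** The reason why blocks are basic: a prime of the excess has disappeared from
   the left side, and at any other prime some a has an exponent at least that
   of b, which the division by gcd(a, q) leaves untouched. *)
Lemma excess_cofactor_logn (A : seq nat) b p : 0 < b ->
  (forall a, a \in A -> 0 < a) -> A != [::] ->
  exists2 a, a \in A & logn p (b %/ excess A b) <= logn p (a %/ gcdn a (excess A b)).
Proof.
move=> b0 A0 An; set q := excess A b.
have lq : logn p q = if p \in excess_primes A b then logn p b else 0.
  exact: logn_partn.
case: ifP lq => pe lq.
  case: A An {A0} @q pe lq => // a A _ q pe lq; exists a; rewrite ?inE ?eqxx //.
  by rewrite logn_div ?excess_dvd // lq subnn.
move: pe; rewrite inE => /negbT /allPn[a aA]; rewrite -leqNgt => h.
exists a => //; rewrite !logn_div ?excess_dvd ?dvdn_gcdl // logn_gcd ?excess_gt0 ?(A0 _ aA) //.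
by rewrite -/q lq minn0 !subn0.
Qed.

(** * Sums over multisets *)

HB.instance Definition _ :=
  Monoid.isComLaw.Build {mset nat} mset0 (@msetD nat)
    (@msetDA nat) (@msetDC nat) (@mset0D nat).

Lemma big_msetD (R : Type) (idx : R) (op : Monoid.com_law idx) (A B : {mset nat}) F :
  \big[op/idx]_(x <- msetD A B) F x =
  op (\big[op/idx]_(x <- A) F x) (\big[op/idx]_(x <- B) F x).
Proof.
rewrite -big_cat; apply: perm_big; apply/allP => x _ /=.
by rewrite count_cat !count_mem_mset msetE2.
Qed.

Lemma big_bigmsetD (R : Type) (idx : R) (op : Monoid.com_law idx) (I : Type)
    (r : seq I) (F : I -> {mset nat}) G :
  \big[op/idx]_(x <- \big[msetD/mset0]_(i <- r) F i) G x =
  \big[op/idx]_(i <- r) \big[op/idx]_(x <- F i) G x.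
Proof.
elim: r => [|i r IH]; first by rewrite !big_nil big_mset0.
by rewrite !big_cons big_msetD IH.
Qed.

Lemma bigmsetDE (I : Type) (r : seq I) (F : I -> {mset nat}) l :
  (\big[msetD/mset0]_(i <- r) F i) l = \sum_(i <- r) F i l.
Proof.
elim: r => [|i r IH]; first by rewrite !big_nil mset0E.
by rewrite !big_cons msetE2 IH.
Qed.

Lemma mem_bigmsetD (I : eqType) (r : seq I) (F : I -> {mset nat}) l :
  reflect (exists2 i, i \in r & l \in F i) (l \in \big[msetD/mset0]_(i <- r) F i).
Proof.
elim: r => [|i r IH]; first by rewrite big_nil in_mset0; constructor => -[].
rewrite big_cons in_msetD; apply: (iffP orP) => [[li|/IH[j jr lj]]|[j]].
- by exists i; rewrite ?inE ?eqxx.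
- by exists j; rewrite ?inE ?jr ?orbT.
by rewrite inE => /orP[/eqP->|jr lj]; [left|right; apply/IH; exists j].
Qed.

Lemma iterop_msetn k n (a : nat) : iterop k (@msetD nat) (msetn n a) mset0 = msetn (k * n) a.
Proof.
rewrite Monoid.iteropE; elim: k => [|k IH]; first by rewrite msetn0.
by apply/msetP => x; rewrite iterS IH msetE2 !msetnE; case: eqP; rewrite ?mulSn.
Qed.

Lemma soc_sizeE (A : {mset nat}) : soc_size A = \sum_(x <- A) x.
Proof. by rewrite /soc_size sum_mset; apply: eq_bigr => l _; rewrite mulnC. Qed.

Lemma soc_gt0 (A : {mset nat}) a : is_soc A -> a \in A -> 0 < a.
Proof. by rewrite /is_soc lt0n => A0; apply: contraL => /eqP ->. Qed.

(** The common form of the quotient, of the block and of the restriction to a set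
   of lengths: the copies of x become w(x) times as many cycles of length f(x). *)
Definition wimage (w f : nat -> nat) (M : {mset nat}) : {mset nat} :=
  \big[msetD/mset0]_(x <- M) msetn (w x) (f x).

Lemma wimage_size w f M : soc_size (wimage w f M) = \sum_(x <- M) w x * f x.
Proof.
rewrite soc_sizeE big_bigmsetD; apply: eq_bigr => x _.
by rewrite big_msetn /= Monoid.iteropE iter_addn addn0 mulnC.
Qed.

Lemma mem_wimage w f (M : {mset nat}) l :
  reflect (exists x, [/\ x \in M, 0 < w x & l = f x]) (l \in wimage w f M).
Proof.
apply: (iffP (mem_bigmsetD _ _ _ _)) => [[x xM /msetnP[w0 ->]]|[x [xM w0 ->]]].
  by exists x.
by exists x => //; rewrite msetn1.
Qed.

Definition part (P : pred nat) (M : {mset nat}) := wimage (fun x => P x) id M.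

Lemma partE P M l : part P M l = P l * M l.
Proof.
rewrite bigmsetDE -count_mem_mset -sum1_count big_distrr /= big_mkcond /= [RHS]big_mkcond.
apply: eq_bigr => x _; rewrite msetnE eq_sym; case: eqP => [->|] //=.
by rewrite muln1.
Qed.

Lemma part_msetD P M N : part P (msetD M N) = msetD (part P M) (part P N).
Proof. by apply/msetP => l; rewrite !(partE, msetE2) mulnDr. Qed.

Lemma part0 P : part P mset0 = mset0.
Proof. by apply/msetP => l; rewrite !partE !mset0E muln0. Qed.

Lemma part_big P (I : Type) (r : seq I) (F : I -> {mset nat}) :
  part P (\big[msetD/mset0]_(i <- r) F i) = \big[msetD/mset0]_(i <- r) part P (F i).
Proof. by rewrite (big_morph (part P) (part_msetD P) (part0 P)). Qed.

Lemma part_msetn P n l : part P (msetn n l) = if P l then msetn n l else mset0.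
Proof.
apply/msetP => x; rewrite partE msetnE; case: eqP => [->|xl].
  by case: (P l); rewrite ?mul1n ?msetnxx ?mset0E.
by rewrite muln0; case: (P l); rewrite ?mset0E // msetnE; case: eqP xl.
Qed.

Lemma soc_scale_big p (I : Type) (r : seq I) (F : I -> {mset nat}) :
  soc_scale (\big[msetD/mset0]_(i <- r) F i) p =
  \big[msetD/mset0]_(i <- r) soc_scale (F i) p.
Proof. exact: big_bigmsetD. Qed.

Lemma soc_scale_msetn n l p : soc_scale (msetn n l) p = msetn n (l * p).
Proof. by rewrite /soc_scale big_msetn iterop_msetn muln1. Qed.

Lemma soc_scaleE (M : {mset nat}) p l : 0 < p -> soc_scale M p (l * p) = M l.
Proof.
move=> p0; rewrite bigmsetDE -count_mem_mset -sum1_count [RHS]big_mkcond.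
by apply: eq_bigr => x _; rewrite msetnE /= eqn_pmul2r // eq_sym; case: eqP.
Qed.

Lemma soc_scale_inj p (M N : {mset nat}) : 0 < p -> soc_scale M p = soc_scale N p -> M = N.
Proof.
by move=> p0 E; apply/msetP => l; rewrite -(soc_scaleE M p) // E soc_scaleE.
Qed.

Lemma mem_soc_scale (M : {mset nat}) p l :
  reflect (exists2 x, x \in M & l = x * p) (l \in soc_scale M p).
Proof.
by apply: (iffP (mem_bigmsetD _ _ _ _)) => -[x xM]; exists x => //; apply/mset1P.
Qed.

Lemma mem_soc_mul (A X : {mset nat}) l : 
  reflect (exists a x, [/\ a \in A, x \in X, 0 < gcdn a x & l = lcmn a x]) (l \in soc_mul A X).
Proof.
apply: (iffP (mem_bigmsetD _ _ _ _)) => [[a aA /mem_bigmsetD[x xX /msetnP[g0 ->]]]|[a [x [aA xX g0 ->]]]].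
  by exists a, x.
by exists a => //; apply/mem_bigmsetD; exists x => //; rewrite msetn1.
Qed.

Lemma soc_mul_big A (I : Type) (r : seq I) (F : I -> {mset nat}) :
  soc_mul A (\big[msetD/mset0]_(i <- r) F i) =
  \big[msetD/mset0]_(i <- r) soc_mul A (F i).
Proof.
rewrite /soc_mul [RHS]exchange_big; apply: eq_bigr => a _; exact: big_bigmsetD.
Qed.

Lemma soc_mul_msetn A n x :
  soc_mul A (msetn n x) = \big[msetD/mset0]_(a <- A) msetn (n * gcdn a x) (lcmn a x).
Proof. by apply: eq_bigr => a _; rewrite big_msetn iterop_msetn. Qed.

(** * The decomposition of the solution set *)

Definition quotient (A : {mset nat}) q := wimage (gcdn^~ q) (fun a => a %/ gcdn a q) A.

Definition block (A B : {mset nat}) q :=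
  wimage (fun b => excess A b == q) (fun b => b %/ q) B.

(** By [gcd_scale] and [lcm_scale], the length factor q and the multiplicity
   gcd(a, q) come out of every product of a cycle of A and a dilated cycle. *)
Lemma soc_mul_scale (A X : {mset nat}) q : is_soc A -> 0 < q -> dominates q A ->
  (forall x, x \in X -> 0 < x /\ coprime x q) ->
  soc_mul A (soc_scale X q) = soc_scale (soc_mul (quotient A q) X) q.
Proof.
move=> socA q0 dom Xq; rewrite soc_mul_big /soc_mul [in RHS]exchange_big soc_scale_big.
apply: eq_big_seq => x xX; have [x0 cop] := Xq _ xX.
rewrite -/(soc_mul A _) soc_mul_msetn big_bigmsetD soc_scale_big.
apply: eq_big_seq => a aA; have a0 := soc_gt0 _ _ socA aA.
rewrite big_msetn iterop_msetn soc_scale_msetn mul1n.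
by rewrite (gcd_scale _ _ _ _ dom aA) // (lcm_scale _ _ _ _ dom aA).
Qed.

(** By [excess_lcm], multiplication by A does not mix the classes of excess. *)
Lemma part_soc_mul (A X : {mset nat}) q : is_soc A -> is_soc X ->
  part (fun x => excess A x == q) (soc_mul A X) =
  soc_mul A (part (fun x => excess A x == q) X).
Proof.
move=> socA socX; rewrite soc_mul_big /soc_mul [in LHS]exchange_big part_big.
apply: eq_big_seq => x xX; rewrite -/(soc_mul A _) soc_mul_msetn part_big.
apply: eq_big_seq => a aA; rewrite part_msetn excess_lcm ?(soc_gt0 _ _ socX xX) //.
  by case: eqP; rewrite ?mul1n ?mul0n ?msetn0.
by move=> ?; apply: soc_gt0.
Qed.

Lemma block_scale (A B : {mset nat}) q :
  soc_scale (block A B q) q = part (fun b => excess A b == q) B.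
Proof.
rewrite soc_scale_big; apply: eq_bigr => b _; rewrite soc_scale_msetn.
by case: eqP => [<-|_]; rewrite ?msetn0 // divnK // excess_dvd.
Qed.

Lemma mem_block (A B : {mset nat}) q x : x \in block A B q ->
  exists b, [/\ b \in B, excess A b = q & b = x * q].
Proof.
move/mem_wimage=> [b [bB]]; rewrite lt0b => /eqP E ->; exists b; split => //.
by rewrite divnK // -E excess_dvd.
Qed.

Lemma block_soc (A B : {mset nat}) q : is_soc B -> is_soc (block A B q).
Proof.
move=> socB; apply/negP => /mem_block[b [bB _ E]].
by have := soc_gt0 _ _ socB bB; rewrite E.
Qed.

Lemma block_coprime (A B : {mset nat}) q x : is_soc B ->
  x \in block A B q -> 0 < x /\ coprime x q.
Proof.
move=> socB xB; have x0 := soc_gt0 _ _ (block_soc A B q socB) xB; split=> //.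
have [b [bB E bE]] := mem_block _ _ _ _ xB.
have := coprime_excess A b (soc_gt0 _ _ socB bB).
by rewrite E bE mulnK 1?coprime_sym // -E excess_gt0.
Qed.

Lemma quotient_size A q : is_soc A -> soc_size (quotient A q) = soc_size A.
Proof.
move=> socA; rewrite wimage_size soc_sizeE; apply: eq_big_seq => a aA.
by rewrite mulnC divnK // dvdn_gcdl.
Qed.

Lemma quotient_soc A q : is_soc A -> is_soc (quotient A q).
Proof.
move=> socA; apply/negP => /mem_wimage[a [aA _ E]].
by have := cofactor_gt0 a q (soc_gt0 _ _ socA aA); rewrite -E.
Qed.

Lemma quotient_neq0 (A : {mset nat}) q : is_soc A -> A <> mset0 -> quotient A q <> mset0.
Proof.
move=> socA An0; have [//|[a aA] Q0] := mset_0Vmem A.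
have : a %/ gcdn a q \in quotient A q.
  by apply/mem_wimage; exists a; split; rewrite // gcdn_gt0 (soc_gt0 A).
by rewrite Q0 in_mset0.
Qed.

(** Each length lies in exactly one of the parts. *)
Lemma big_part (A B : {mset nat}) (qs : seq nat) : uniq qs ->
  (forall b, b \in B -> excess A b \in qs) ->
  \big[msetD/mset0]_(q <- qs) part (fun b => excess A b == q) B = B.
Proof.
move=> Uqs qsP; apply/msetP => l; rewrite bigmsetDE.
under eq_bigr do rewrite partE.
case: (posnP (B l)) => [->|]; first by rewrite big1 // => q _; rewrite muln0.
rewrite -in_mset => /qsP lqs; rewrite (bigD1_seq (excess A l)) //= eqxx mul1n.
by rewrite big1 ?addn0 // => q; rewrite eq_sym => /negbTE ->.
Qed.

Lemma mem_lengths (A : {mset nat}) l : (l \in lengths A) = (l \in A).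
Proof. exact: msuppE. Qed.

Lemma dvd_lcm_set (A : {mset nat}) a : a \in A -> a %| lcm_set (lengths A).
Proof.
rewrite -mem_lengths /lcm_set => aA.
by rewrite (big_fsetD1 a) //= dvdn_lcml.
Qed.

Lemma lcm_set_dvd (A : {mset nat}) m : (forall a, a \in A -> a %| m) -> lcm_set (lengths A) %| m.
Proof.
move=> H; rewrite /lcm_set big_seq; elim/big_ind: _ => // [x y xm ym|a].
  by rewrite dvdn_lcm xm.
by rewrite mem_lengths => /H.
Qed.

Lemma lcm_set_gt0 (A : {mset nat}) : is_soc A -> 0 < lcm_set (lengths A).
Proof.
move=> socA; rewrite /lcm_set big_seq; elim/big_ind: _ => // [x y xm ym|a].
  by rewrite lcmn_gt0 xm.
by rewrite mem_lengths; apply: soc_gt0.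
Qed.

Lemma quotient_lcm (A : {mset nat}) q :
  lcm_set (lengths (quotient A q)) %| lcm_set (lengths A).
Proof.
apply: lcm_set_dvd => _ /mem_wimage[a [aA _ ->]].
by apply: dvdn_trans (dvd_lcm_set _ _ aA); rewrite dvdn_div // dvdn_gcdl.
Qed.

Lemma block_basic (A B : {mset nat}) q : is_instance A B ->
  basic (quotient A q) (block A B q).
Proof.
case=> socA socB An0 _ x; rewrite mem_lengths => xB.
have [b [bB E bE]] := mem_block _ _ _ _ xB.
have b0 := soc_gt0 _ _ socB bB.
have q0 : 0 < q by rewrite -E excess_gt0.
have x0 := (block_coprime _ _ _ _ socB xB).1.
have L0 := lcm_set_gt0 _ (quotient_soc _ q socA).
apply/dvdn_partP => // p px; rewrite p_part pfactor_dvdn //; last first.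
  by move: px; rewrite mem_primes => /andP[].
have [a aA le] : exists2 a, a \in A & logn p (b %/ excess A b) <= logn p (a %/ gcdn a (excess A b)).
  apply: excess_cofactor_logn => //; first by move=> a; apply: soc_gt0.
  by have [//|[a aA]] := mset_0Vmem A; apply: contraTneq (aA : a \in enum_mset A) => ->.
move: le; rewrite E bE mulnK // => le; apply: (leq_trans le); apply: dvdn_leq_log => //.
apply/dvd_lcm_set/mem_wimage; exists a; split=> //.
by rewrite gcdn_gt0 q0 orbT.
Qed.

Lemma block_sizes (A B : {mset nat}) (qs : seq nat) : uniq qs -> 
  \sum_(q <- qs) soc_size (block A B q) <= soc_size B.
Proof.
move=> Uqs; rewrite soc_sizeE; under eq_bigr do rewrite wimage_size.
rewrite exchange_big; apply: leq_sum => b _ /=.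
case: (boolP (excess A b \in qs)) => [bq|bq].
  rewrite (bigD1_seq (excess A b)) //= eqxx mul1n big1 ?addn0 ?leq_div //.
  by move=> q; rewrite eq_sym => /negbTE ->.
rewrite big_seq big1 // => q qqs; case: eqP bq => // ->; by rewrite qqs.
Qed.

Local Open Scope classical_set_scope.

Lemma mem_big_set_add (qs : seq nat) (F : nat -> set {mset nat}) X : uniq qs ->
  (\big[set_add/[set mset0]]_(q <- qs) F q) X <->
  exists Y, (forall q, q \in qs -> F q (Y q)) /\ X = \big[msetD/mset0]_(q <- qs) Y q.
Proof.
elim: qs X => [|q qs IH] X /=.
  by rewrite big_nil; split => [->|[Y [_ ->]]]; [exists (fun=> mset0)|]; rewrite big_nil.
case/andP=> qqs /IH{}IH; rewrite big_cons; split.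
  case=> Z FZ [W /IH[Y [FY ->]] <-]; exists (fun r => if r == q then Z else Y r).
  split=> [r|].
    by rewrite inE; case: eqP => [->|_] //= /FY.
  rewrite big_cons eqxx; congr msetD; apply: eq_big_seq => r rqs.
  by case: eqP => // E; rewrite -E rqs in qqs.
case=> Y [FY ->]; rewrite big_cons; exists (Y q); first by apply: FY; rewrite inE eqxx.
exists (\big[msetD/mset0]_(r <- qs) Y r) => //; apply/IH; exists Y; split=> // r rqs.
by apply: FY; rewrite inE rqs orbT.
Qed.

(** A length y of a solution divides some lcm(a, y), which is a length of the
   block and hence coprime to q. *)
Lemma Sol_block_coprime (A B Y : {mset nat}) q y : is_instance A B ->
  Sol (quotient A q) (block A B q) Y -> y \in Y -> 0 < y /\ coprime y q.
Proof.
move=> [socA socB An0 _] [socY E] yY; have y0 := soc_gt0 _ _ socY yY; split=> //.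
have [|[a aA]] := mset_0Vmem (quotient A q); first by move/(quotient_neq0 _ _ socA An0).
have : lcmn a y \in block A B q.
  by rewrite -E; apply/mem_soc_mul; exists a, y; rewrite gcdn_gt0 y0 orbT.
move/(block_coprime _ _ _ _ socB) => [_]; apply: coprime_dvdl; exact: dvdn_lcmr.
Qed.

(** A solution X is cut into its own blocks, each of which solves its part of the
   equation because dilation by q is injective.  Conversely the dilated
   solutions multiply to the parts of B of given excess, which add up to B. *)
Lemma Sol_decomposition (A B : {mset nat}) (qs : seq nat) : is_instance A B -> uniq qs ->
  (forall b, b \in B -> excess A b \in qs) ->
  (forall q, q \in qs -> exists b, excess A b = q) ->
  Sol A B = \big[set_add/[set mset0]]_(q <- qs)
    set_scale (Sol (quotient A q) (block A B q)) q.
Proof.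
move=> inst Uqs Bqs qsB; have [socA socB An0 _] := inst.
have qs0 q : q \in qs -> 0 < q by move=> /qsB[b <-]; apply: excess_gt0.
have qdom q : q \in qs -> dominates q A by move=> /qsB[b <-]; apply: excess_dominates.
apply/seteqP; split => X.
  case=> socX E; apply/mem_big_set_add => //.
  exists (fun q => soc_scale (block A X q) q); split=> [q qqs|]; last first.
    under eq_bigr do rewrite block_scale.
    rewrite big_part // => x xX; have [//|[a aA]] := mset_0Vmem A.
    have x0 := soc_gt0 _ _ socX xX.
    rewrite -(excess_lcm _ a) //; last by move=> ?; apply: soc_gt0.
    by apply: Bqs; rewrite -E; apply/mem_soc_mul; exists a, x; rewrite gcdn_gt0 x0 orbT.
  exists (block A X q) => //; split; first exact: block_soc.
  apply: (soc_scale_inj q); first exact: qs0.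
  rewrite -soc_mul_scale ?qs0 //; [|exact: qdom|by move=> x; apply: block_coprime].
  by rewrite !block_scale -part_soc_mul // E.
move/(mem_big_set_add _ _ _ Uqs) => [Z [FZ ->]]; split.
  apply/mem_bigmsetD => -[q qqs]; have [Y SY <-] := FZ q qqs.
  move/mem_soc_scale => [y yY] /eqP; rewrite eq_sym muln_eq0.
  have [/lt0n_neq0/negbTE-> _] := Sol_block_coprime _ _ _ _ _ inst SY yY.
  by rewrite (gtn_eqF (qs0 _ qqs)).
rewrite soc_mul_big -[RHS](big_part A _ _ Uqs Bqs); apply: eq_big_seq => q qqs.
have [Y SY <-] := FZ q qqs; rewrite soc_mul_scale ?qs0 //; last first.
- by move=> y; apply: Sol_block_coprime SY.
- exact: qdom.
by rewrite SY.2 block_scale.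
Qed.

Local Close Scope classical_set_scope.

(** The support of a consistent instance is non-empty, as B is, and its elements
   are at most |B| / |A|. *)
Lemma consistent_size A B : is_instance A B -> consistent A B -> soc_size A <= soc_size B.
Proof.
move=> [socA _ _ Bn0] cons; have [//|[b]] := mset_0Vmem B.
rewrite -mem_lengths -cons => /imfset2P[a _ [x]].
rewrite !inE => /andP[+ _] _; rewrite mem_iota => /andP[x1 x2].
have : 0 < soc_size B %/ soc_size A by lia.
by case: (posnP (soc_size A)) => [-> //|A0]; rewrite divn_gt0.
Qed.


(** * Weakest preconditions for timed programs *)

(** The unbounded value of an expression; [safe] carries the word bounds. *)
Fixpoint den (s : state) (e : expr) : nat :=
  match e with
  | Cst n => n
  | Reg x => reg s x
  | Mem a => mem s (den s a)
  | Bin o e1 e2 => eval_op o (den s e1) (den s e2)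
  end.

Fixpoint safe (W : nat) (s : state) (e : expr) : Prop :=
  match e with
  | Cst n => n <= W
  | Reg x => reg s x <= W
  | Mem a => safe W s a /\ mem s (den s a) <= W
  | Bin o e1 e2 =>
      [/\ safe W s e1, safe W s e2 & eval_op o (den s e1) (den s e2) <= W]
  end.

Lemma eval_den W s e : safe W s e -> eval W s e = Some (den s e).
Proof.
elim: e => [n|x|a IH|o e1 IH1 e2 IH2] /=; rewrite /word; try by move=> ->.
  by case=> /IH -> ->.
by case=> /IH1 -> /IH2 -> ->.
Qed.

(** The elapsed time is an argument of the postcondition, so that the times of
   consecutive commands add up symbolically and are compared with a bound
   once, at the end. *)
Definition wp (W : nat) (p : cmd) (s : state) (Q : nat -> state -> Prop) : Prop :=
  exists t s', exec W p s t s' /\ Q t s'.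

Definition set_reg (s : state) (x v : nat) := State (update (reg s) x v) (mem s).

Definition set_mem (s : state) (i v : nat) := State (reg s) (update (mem s) i v).

Lemma wp_weaken W p s (Q Q' : nat -> state -> Prop) :
  wp W p s Q -> (forall t s', Q t s' -> Q' t s') -> wp W p s Q'.
Proof. by case=> t [s' [ex q]] H; exists t, s'; split=> //; apply: H. Qed.

Lemma wp_skip W s (Q : nat -> state -> Prop) : Q 1 s -> wp W Skip s Q.
Proof. by move=> q; exists 1, s; split=> //; apply: ExecSkip. Qed.

Lemma wp_seq W p q s (Q : nat -> state -> Prop) :
  wp W p s (fun t s' => wp W q s' (fun t' => Q (t + t'))) -> wp W (Seq p q) s Q.
Proof.
case=> t [s' [ex [t' [s'' [ex' q']]]]]; exists (t + t'), s''; split=> //.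
exact: ExecSeq ex'.
Qed.

Lemma wp_set_reg W s x e (Q : nat -> state -> Prop) : safe W s e ->
  Q (cost e).+1 (set_reg s x (den s e)) -> wp W (SetReg x e) s Q.
Proof.
by move=> /eval_den E q; exists (cost e).+1, (set_reg s x (den s e)); split=> //; constructor.
Qed.

Lemma wp_set_mem W s a e (Q : nat -> state -> Prop) : safe W s a -> safe W s e ->
  Q (cost a + cost e).+1 (set_mem s (den s a) (den s e)) -> wp W (SetMem a e) s Q.
Proof.
move=> /eval_den Ea /eval_den Ee q.
by exists (cost a + cost e).+1, (set_mem s (den s a) (den s e)); split=> //; constructor.
Qed.

Lemma wp_if W s e p q (Q : nat -> state -> Prop) : safe W s e ->
  (den s e != 0 -> wp W p s (fun t => Q ((cost e).+1 + t))) ->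
  (den s e = 0 -> wp W q s (fun t => Q ((cost e).+1 + t))) ->
  wp W (If e p q) s Q.
Proof.
move=> /eval_den E Hp Hq; have [e0|e0] := eqVneq (den s e) 0.
  have [t [s' [ex q']]] := Hq e0; exists ((cost e).+1 + t), s'; split=> //.
  by apply: ExecIfFalse; rewrite ?E ?e0.
have [t [s' [ex q']]] := Hp e0; exists ((cost e).+1 + t), s'; split=> //.
by apply: ExecIfTrue ex; rewrite ?E.
Qed.

(** The index of the invariant decreases at each round, hence its initial value
   bounds their number. *)
Lemma wp_while W e p T (I : nat -> state -> Prop) k s (Q : nat -> state -> Prop) :
  (forall k s, I k s -> safe W s e) ->
  (forall k s, I k s -> den s e != 0 ->
     wp W p s (fun t s' => t <= T /\ exists2 k', k' < k & I k' s')) ->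
  I k s ->
  (forall t s' k', t <= k * ((cost e).+1 + T) + (cost e).+1 -> I k' s' ->
     den s' e = 0 -> Q t s') ->
  wp W (While e p) s Q.
Proof.
move=> Isafe Istep Ik HQ.
suff [t [s' [ex [k' [lt Ik' e0]]]]] : exists t s', exec W (While e p) s t s' /\
    exists k', [/\ t <= k * ((cost e).+1 + T) + (cost e).+1, I k' s' & den s' e = 0].
  by exists t, s'; split=> //; apply: HQ Ik' e0.
move: Ik {HQ}; elim/ltn_ind: k s => k IH s Ik.
have E := eval_den _ _ _ (Isafe _ _ Ik).
have [e0|e0] := eqVneq (den s e) 0.
  exists (cost e).+1, s; split; first by apply: ExecWhileFalse; rewrite E e0.
  by exists k; rewrite leq_addl.
have [t1 [s1 [ex1 [t1T [k1 k1k Ik1]]]]] := Istep _ _ Ik e0.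
have [t2 [s2 [ex2 [k2 [t2T Ik2 s2e]]]]] := IH _ k1k _ Ik1.
exists ((cost e).+1 + t1 + t2), s2; split; first exact: ExecWhileTrue E e0 ex1 ex2.
exists k2; split=> //; apply: leq_trans (_ : k1.+1 * ((cost e).+1 + T) + (cost e).+1 <= _).
  by rewrite mulSn -[leqRHS]addnA leq_add // leq_add2l.
by rewrite leq_add2r leq_mul2r k1k orbT.
Qed.

(** The counter is incremented before the body, which thus sees 1, ..., n. *)
Definition for_to (i n : nat) (body : cmd) : cmd :=
  Seq (SetReg i (Cst 0))
    (While (Bin Sub (Reg n) (Reg i))
       (Seq (SetReg i (Bin Add (Reg i) (Cst 1))) body)).

(** Per round, the test costs 4 and the increment 4; entering and leaving the loop
   costs 6 more. *)
Lemma wp_for W i rn body n T (I : nat -> state -> Prop) s (Q : nat -> state -> Prop) :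
  i != rn -> n < W -> reg s rn = n ->
  I 0 (set_reg s i 0) ->
  (forall k s, k < n -> reg s rn = n -> I k s ->
     wp W body (set_reg s i k.+1) (fun t s' =>
       [/\ t <= T, reg s' rn = n, reg s' i = k.+1 & I k.+1 s'])) ->
  (forall t s', t <= n * (T + 8) + 6 -> reg s' rn = n -> I n s' -> Q t s') ->
  wp W (for_to i rn body) s Q.
Proof.
move=> irn nW sn I0 Istep HQ; apply: wp_seq; apply: wp_set_reg => //=.
pose J j s := exists k, [/\ k + j = n, reg s rn = n, reg s i = k & I k s].
apply: (@wp_while W _ _ (T + 4) J n).
- by move=> j s1 [k [kj s1n s1i _]] /=; rewrite s1n s1i; split; lia.
- move=> j s1 [k [kj s1n s1i Ik]] /=; rewrite s1n s1i => nk.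
  apply: wp_seq; apply: wp_set_reg => /=; first by rewrite s1i; split; lia.
  rewrite s1i addn1.
  apply: wp_weaken (Istep k s1 _ s1n Ik) _; first by lia.
  move=> t s2 [tT s2n s2i Ik2]; split; first by lia.
  by exists j.-1; [lia|exists k.+1; split=> //; lia].
- by exists 0; rewrite /= /update eqxx (eq_sym rn) (negbTE irn).
move=> t s' j /= tle [k [kj s1n s1i Ik]]; rewrite s1n s1i => nk.
have kn : k = n by lia.
by apply: HQ => //; [lia|rewrite -kn].
Qed.

Ltac simpl_state := rewrite /set_reg /set_mem /update /=.

(** In all programs below, a command overwrites only registers numbered from a
   threshold on, its subcommands using higher thresholds: Euclid's algorithm
   works in the registers 20 to 22. *)
Definition gcd_cmd (e1 e2 : expr) : cmd :=
  Seq (SetReg 21 e1)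
 (Seq (SetReg 20 e2)
      (While (Reg 21)
        (Seq (SetReg 22 (Bin Mod (Reg 20) (Reg 21)))
        (Seq (SetReg 20 (Reg 21))
             (SetReg 21 (Reg 22)))))).

(** The second entry decreases at each round, so v1 bounds the number of rounds;
   this linear bound is enough for a cubic total. *)
Lemma wp_gcd W e1 e2 v1 v2 s (Q : nat -> state -> Prop) :
  safe W s e1 -> den s e1 = v1 ->
  safe W (set_reg s 21 v1) e2 -> den (set_reg s 21 v1) e2 = v2 ->
  v1 <= W -> v2 <= W ->
  (forall t s', t <= 10 * v1 + (cost e1 + cost e2 + 4) ->
     reg s' 20 = gcdn v1 v2 -> mem s' = mem s ->
     (forall r, r < 20 -> reg s' r = reg s r) -> Q t s') ->
  wp W (gcd_cmd e1 e2) s Q.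
Proof.
move=> S1 D1 S2 D2 W1 W2 HQ; apply: wp_seq; apply: wp_set_reg; rewrite ?D1 //.
apply: wp_seq; apply: wp_set_reg; rewrite ?D2 //.
pose I k s' := [/\ reg s' 21 = k, reg s' 20 <= W, k <= W, gcdn k (reg s' 20) = gcdn v1 v2 &
  mem s' = mem s /\ forall r, r < 20 -> reg s' r = reg s r].
apply: (@wp_while W _ _ 8 I v1).
- by move=> k s1 [/= -> _].
- move=> k s1 [s1k b20 kW g [sm sr]] /=; rewrite s1k => k0.
  have lt : reg s1 20 %% k < k by rewrite ltn_mod lt0n.
  apply: wp_seq; apply: wp_set_reg => /=; rewrite s1k; first by split=> //; lia.
  apply: wp_seq; apply: wp_set_reg; simpl_state; first by rewrite s1k.
  apply: wp_set_reg; simpl_state; first by lia.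
  split=> //; exists (reg s1 20 %% k) => //; split; rewrite /= ?s1k //.
  - by lia.
  - by rewrite gcdnC gcdn_modr g.
  - split=> // r r20; simpl_state; rewrite -sr //.
    by rewrite !ifN //; apply/eqP; lia.
- split=> //=; split=> // r r20; simpl_state.
  by rewrite !ifN //; apply/eqP; lia.
move=> t s' k /= tle [s1k b20 kW g [sm sr]] k0; apply: HQ => //; first by lia.
by move: g; rewrite -s1k k0 gcd0n.
Qed.


(** * Writing the image of a sum of cycles *)

Lemma mem_leq_size (M : {mset nat}) x : x \in M -> x * M x <= soc_size M.
Proof.
by move=> xM; rewrite /soc_size (big_fsetD1 x) ?msuppE //= leq_addr.
Qed.

Lemma leq_soc_size (M : {mset nat}) x : x \in M -> x <= soc_size M.
Proof.
by move=> xM; apply: leq_trans (mem_leq_size _ _ xM); rewrite leq_pmulr // -in_mset.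
Qed.

Lemma count_leq_size (M : {mset nat}) x : x * M x <= soc_size M.
Proof.
case: (posnP (M x)) => [->|]; first by rewrite muln0.
by rewrite -in_mset; apply: mem_leq_size.
Qed.

Lemma sum_soc (M : {mset nat}) F : is_soc M ->
  \sum_(x <- M) F x = \sum_(1 <= x < (soc_size M).+1) M x * F x.
Proof.
move=> socM; rewrite sum_mset [RHS](bigID (fun x => x \in M)) /=.
rewrite [X in _ + X]big1 ?addn0; last by move=> x /mset_eq0P ->.
rewrite -[RHS]big_filter; apply: perm_big; apply: uniq_perm.
- exact: fset_uniq.
- by rewrite filter_uniq // iota_uniq.
move=> x; rewrite mem_filter mem_index_iota msuppE; case: (boolP (x \in M)) => //= xM.
by rewrite ltnS leq_soc_size // (soc_gt0 M).
Qed.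

(** The presentation [encode_soc] of M, stored from address a on. *)
Definition holds_soc (m : nat -> nat) (a : nat) (M : {mset nat}) : Prop :=
  m a = soc_size M /\ forall x, 0 < x <= soc_size M -> m (a + x) = M x.

(** Registers: 6 is the address of the source, 7 that of the target, 8 the number
   of vertices of the source, 9 the current length, 10 the size of the image.
   The command [step] computes the weight and the image of the current length in
   the registers 11 and 12.  The target is cleared from its very first cell:
   a length of image 0 updates that cell, which the size finally overwrites. *)
Definition scatter (step : cmd) : cmd :=
  Seq (SetReg 8 (Mem (Reg 6)))
 (Seq (SetMem (Reg 7) (Cst 0))
 (Seq (for_to 9 8 (SetMem (Bin Add (Reg 7) (Reg 9)) (Cst 0)))
 (Seq (SetReg 10 (Cst 0))
 (Seq (for_to 9 8
        (Seq step
        (Seq (SetReg 11 (Bin Mul (Mem (Bin Add (Reg 6) (Reg 9))) (Reg 11)))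
        (Seq (SetReg 10 (Bin Add (Reg 10) (Bin Mul (Reg 11) (Reg 12))))
             (SetMem (Bin Add (Reg 7) (Reg 12))
                (Bin Add (Mem (Bin Add (Reg 7) (Reg 12))) (Reg 11)))))))
      (SetMem (Reg 7) (Reg 10)))))).

(** Since w(x) f(x) <= x, the size of the image is at most |M|: the cleared cells
   contain the whole presentation of the image and all partial sums are
   words. *)
Lemma wp_scatter W step M w f s S D T (Q : nat -> state -> Prop) :
  is_soc M -> holds_soc (mem s) S M -> reg s 6 = S -> reg s 7 = D ->
  S + soc_size M < D -> D + soc_size M < W ->
  (forall x, 0 < x -> [/\ w x <= x, f x <= x & w x * f x <= x]) ->
  (forall s1 x, 0 < x <= soc_size M -> reg s1 9 = x ->
     (forall r, r < 8 -> reg s1 r = reg s r) ->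
     (forall i, i < D -> mem s1 i = mem s i) ->
     wp W step s1 (fun t s2 => [/\ t <= T, reg s2 11 = w x, reg s2 12 = f x,
        mem s2 = mem s1 & forall r, r < 11 -> reg s2 r = reg s1 r])) ->
  (forall t s', t <= soc_size M * (T + 60) + 60 ->
     reg s' 10 = soc_size (wimage w f M) ->
     holds_soc (mem s') D (wimage w f M) ->
     (forall r, r < 8 -> reg s' r = reg s r) ->
     (forall i, i < D -> mem s' i = mem s i) -> Q t s') ->
  wp W (scatter step) s Q.
Proof.
move=> socM [MS Mx] s6 s7 SD DW wf Hstep HQ; set N := soc_size M in MS Mx SD DW Hstep HQ.
pose count k i := \sum_(1 <= x < k.+1) M x * w x * (f x == i).
pose total k := \sum_(1 <= x < k.+1) M x * w x * f x.
have NE : N = \sum_(1 <= x < N.+1) M x * x by rewrite -sum_soc // -soc_sizeE.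
have sub F k : k <= N -> (forall x, 0 < x -> F x <= x) ->
    \sum_(1 <= x < k.+1) M x * F x <= N.
  move=> kN HF; rewrite NE [leqRHS](@big_cat_nat _ _ _ k.+1) //=.
  apply: leq_trans (leq_addr _ _); rewrite !big_nat; apply: leq_sum => x /andP[x0 _].
  by rewrite leq_mul2l HF ?orbT.
have countN k i : k <= N -> count k i <= N.
  move=> kN; rewrite /count; under eq_bigr do rewrite -mulnA.
  apply: sub => // x /wf[wx _ _]; by case: eqP; rewrite ?muln1 ?muln0.
have totalN k : k <= N -> total k <= N.
  move=> kN; rewrite /total; under eq_bigr do rewrite -mulnA.
  by apply: sub => // x /wf[].
have countE i : count N i = wimage w f M i.
  rewrite /wimage bigmsetDE sum_soc //; apply: eq_bigr => x _.
  by rewrite msetnE eq_sym; case: eqP; rewrite ?muln1 ?muln0.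
have totalE : total N = soc_size (wimage w f M).
  by rewrite wimage_size sum_soc //; apply: eq_bigr => x _; rewrite mulnA.
have countS k i : count k.+1 i = count k i + M k.+1 * w k.+1 * (f k.+1 == i).
  by rewrite /count big_nat_recr.
have totalS k : total k.+1 = total k + M k.+1 * w k.+1 * f k.+1.
  by rewrite /total big_nat_recr.
apply: wp_seq; apply: wp_set_reg; simpl_state; rewrite ?s6 ?MS; first by split; lia.
apply: wp_seq; apply: wp_set_mem; simpl_state; rewrite ?s7 //; first by lia.
(* First loop: the target is cleared. *)
pose I0 k s1 := [/\ forall r, r < 8 -> reg s1 r = reg s r,
  forall i, i < D -> mem s1 i = mem s i & forall i, i <= k -> mem s1 (D + i) = 0].
apply: wp_seq; apply: (@wp_for W 9 8 _ N 5 I0) => //; first by lia.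
- split=> /= [r r8|i iD|i].
  + by simpl_state; rewrite !ifN //; apply/eqP; lia.
  + by simpl_state; rewrite ifN //; apply/eqP; lia.
  by rewrite leqn0 => /eqP ->; rewrite /update addn0 eqxx.
- move=> k s1 kN s1N [I1 I2 I3]; have r7 : reg s1 7 = D by rewrite I1.
  apply: wp_set_mem; simpl_state; rewrite ?r7 //.
    by split; lia.
  split=> //; split=> /= [r r8|i iD|i].
  + by simpl_state; rewrite ifN ?I1 //; apply/eqP; lia.
  + by simpl_state; rewrite ifN ?I2 //; apply/eqP; lia.
  by simpl_state; rewrite eqn_add2l leq_eqVlt; case: eqP => //= _; apply: I3.
move=> t1 s1 t1le s1N [s1r s1m s1z].
apply: wp_seq; apply: wp_set_reg; simpl_state => //.
(* Second loop: after the lengths up to k, the target holds partial counts. *)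
pose I k s2 := [/\ forall r, r < 8 -> reg s2 r = reg s r,
  forall i, i < D -> mem s2 i = mem s i,
  reg s2 10 = total k &
  forall i, i <= N -> mem s2 (D + i) = count k i].
apply: wp_seq; apply: (@wp_for W 9 8 _ N (T + 27) I) => //; first by lia.
- split=> /= [r r8|//||i iN].
  + by simpl_state; rewrite !ifN ?s1r //; apply/eqP; lia.
  + by simpl_state; rewrite /total big_geq.
  by simpl_state; rewrite s1z // /count big_geq.
- move=> k s2 kN s2N [I1 I2 I3 I4].
  have [wk fk wfk] := wf k.+1 isT.
  have Mk : k.+1 * M k.+1 <= N by apply: count_leq_size.
  have Mw : M k.+1 * w k.+1 <= N by apply: leq_trans Mk; rewrite mulnC leq_mul2r wk orbT.
  have Mwf : M k.+1 * w k.+1 * f k.+1 <= N.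
    by apply: leq_trans Mk; rewrite -mulnA mulnC leq_mul2r wfk orbT.
  apply: wp_seq; apply: (wp_weaken _ _ _ _ _ (Hstep _ k.+1 _ _ _ _)) => //.
    by move=> r r8; simpl_state; rewrite ifN ?I1 //; apply/eqP; lia.
  move=> t s3 [tT s3w s3f s3m s3r].
  have s3M : mem s3 (S + k.+1) = M k.+1.
    by rewrite s3m /= I2 ?Mx //; lia.
  have r6 : reg s3 6 = S by rewrite s3r //; simpl_state; rewrite I1.
  have r7 : reg s3 7 = D by rewrite s3r //; simpl_state; rewrite I1.
  have r9 : reg s3 9 = k.+1 by rewrite s3r.
  have r10 : reg s3 10 = total k by rewrite s3r.
  apply: wp_seq; apply: wp_set_reg; simpl_state; rewrite ?r6 ?r9 ?s3M ?s3w ?r7.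
    by do ?split; rewrite ?(leq_trans Mw) //; lia.
  have tk := totalN k.+1 kN; rewrite totalS in tk.
  apply: wp_seq; apply: wp_set_reg; simpl_state; rewrite ?r10 ?s3f.
    by do ?split; rewrite ?(leq_trans Mw) ?(leq_trans Mwf) ?(leq_trans tk) //; lia.
  have ck := countN k.+1 (f k.+1) kN; rewrite countS eqxx muln1 in ck.
  have fN : f k.+1 <= N by apply: leq_trans fk kN.
  have s3c : mem s3 (D + f k.+1) = count k (f k.+1) by rewrite s3m /= I4.
  apply: wp_set_mem; simpl_state; rewrite ?r7 ?s3f ?s3c.
  - by split; lia.
  - by do ?split; rewrite ?(leq_trans Mw) ?(leq_trans ck) ?(leq_trans (countN _ _ (ltnW kN))) //; lia.
  split; [by lia|by rewrite s3r|by []|split=> /= [r r8|i iD||i iN]].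
  + by simpl_state; rewrite !ifN ?s3r; simpl_state;
      rewrite ?ifN ?I1 //; try (apply/eqP); lia.
  + by simpl_state; rewrite ifN ?s3m ?I2 //; apply/eqP; lia.
  + by simpl_state; rewrite totalS.
  simpl_state; rewrite eqn_add2l countS eq_sym; case: eqP => [->|_].
    by rewrite muln1.
  by rewrite muln0 addn0 s3m /= I4.
move=> t2 s2 t2le s2N [I1 I2 I3 I4]; have r7 : reg s2 7 = D by rewrite I1.
apply: wp_set_mem; simpl_state; rewrite ?r7 ?I3 ?totalE //; first by lia.
  by have := totalN N (leqnn _); rewrite totalE; lia.
apply: HQ => /=; [by lia|by rewrite I3 totalE| |by []|].
- split=> /= [|x xN]; first by rewrite /update eqxx -totalE.
  rewrite /update ifN; last by apply/eqP; lia.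
  rewrite I4 ?countE //.
  by have := totalN N (leqnn _); rewrite totalE; lia.
- by move=> i iD; simpl_state; rewrite ifN ?I2 //; apply/eqP; lia.
Qed.


(** * The table of excesses *)

Lemma eq_excess (A A' : seq nat) b : A =i A' -> excess A b = excess A' b.
Proof. by move=> E; apply: eq_partn => p; rewrite !inE (eq_all_r E). Qed.

Lemma biggcd_dvd (A : seq nat) b : \big[gcdn/b]_(a <- A) (b %/ gcdn b a) %| b.
Proof.
elim: A => [|a A IH]; first by rewrite big_nil.
by rewrite big_cons (dvdn_trans (dvdn_gcdr _ _)).
Qed.

(** The lengths of A met so far by the loop are listed in reverse, so that the
   fold of gcds grows by its head. *)
Lemma rev_iotaS k : rev (iota 1 k.+1) = k.+1 :: rev (iota 1 k).
Proof. by rewrite -{1}[k.+1]addn1 iotaD rev_cat. Qed.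

(** Registers: 1 and 2 hold |A| and |B|, 4 is the current b, 5 the gcd r of the
   numbers b / gcd(b, a), 6 the current gcd(b, r^j).  The table follows the
   input in memory. *)
Definition excess_table : cmd :=
  for_to 4 2
   (Seq (SetReg 5 (Reg 4))
   (Seq (for_to 7 1
          (If (Mem (Reg 7))
             (Seq (gcd_cmd (Reg 7) (Reg 4))
             (Seq (gcd_cmd (Bin Div (Reg 4) (Reg 20)) (Reg 5))
                  (SetReg 5 (Reg 20))))
             Skip))
   (Seq (SetReg 6 (Cst 1))
   (Seq (for_to 7 4
          (Seq (gcd_cmd (Reg 4) (Bin Mul (Reg 6) (Reg 5)))
               (SetReg 6 (Reg 20))))
        (SetMem (Bin Add (Bin Add (Bin Add (Reg 1) (Reg 2)) (Cst 1)) (Reg 4))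
           (Reg 6)))))).

(** For each b, the first inner loop makes |A| <= n rounds and the second at most
   n, each of linear time. *)
Lemma wp_excess_table W A n s (Q : nat -> state -> Prop) : is_soc A ->
  holds_soc (mem s) 0 A -> reg s 1 = soc_size A -> reg s 2 = n ->
  soc_size A <= n -> 9 * (n.+2 * n.+2) <= W ->
  (forall t s', t <= n * (n * (30 * n + 70) + 50) + 6 ->
     (forall r, r < 4 -> reg s' r = reg s r) ->
     (forall i, i <= soc_size A + n + 1 -> mem s' i = mem s i) ->
     (forall b, 0 < b <= n -> mem s' (soc_size A + n + 1 + b) = excess A b) ->
     Q t s') ->
  wp W excess_table s Q.
Proof.
move=> socA [_ Ax]; set m := soc_size A => s1E s2E mn WE HQ.
have nW : 9 * n + 9 <= W by apply: leq_trans WE; nia.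
have nnW : n * n <= W by apply: leq_trans WE; nia.
pose I k s1 := [/\ forall r, r < 4 -> reg s1 r = reg s r,
  forall i, i <= m + n + 1 -> mem s1 i = mem s i &
  forall b, 0 < b <= k -> mem s1 (m + n + 1 + b) = excess A b].
apply: (@wp_for W 4 2 _ n (n * (30 * n + 70) + 42) I) => //; first by lia.
- split=> // [r r4|b]; last by lia.
  by simpl_state; rewrite ifN //; apply/eqP; lia.
- move=> k s1 kn s1n [I1 I2 I3]; set b := k.+1.
  have bn : b <= n by [].
  have r1 : reg s1 1 = m by rewrite I1.
  apply: wp_seq; apply: wp_set_reg; simpl_state; first by rewrite -/b; lia.
  (* The elements of A among 1, ..., j, and the gcd that they yield. *)
  pose As j := [seq a <- rev (iota 1 j) | a \in A].
  pose r j := \big[gcdn/b]_(a <- As j) (b %/ gcdn b a).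
  have r_dvd j : r j %| b by apply: biggcd_dvd.
  have r_le j : r j <= b by apply: dvdn_leq.
  pose J j s2 := [/\ forall r, r < 5 -> reg s2 r = if r == 4 then b else reg s1 r,
    mem s2 = mem s1 & reg s2 5 = r j].
  apply: wp_seq; apply: (@wp_for W 7 1 _ m (20 * n + 30) J) => //; first by lia.
  + split=> //= [i i5|]; last by simpl_state; rewrite /r /As /= big_nil.
    by simpl_state; rewrite ifN 1?ifN //; apply/eqP; lia.
  + move=> j s2 jm s2m [J1 J2 J3]; set a := j.+1.
    have r4 : reg s2 4 = b by rewrite J1.
    have Aa : A a <= m.
      by apply: leq_trans (count_leq_size A a); rewrite leq_pmull.
    have memA : mem s2 a = A a by rewrite J2 I2 -?Ax ?add0n //; lia.
    apply: wp_if; simpl_state; rewrite memA; first by lia.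
      rewrite mset_neq0 => aA.
      have rS : r a = gcdn (b %/ gcdn b a) (r j).
        by rewrite /r /As rev_iotaS /= aA big_cons.
      have gb : b %/ gcdn b a <= b by apply: leq_div.
      have gb' : b %/ gcdn a b <= b by apply: leq_div.
      have g0 : gcdn a b <= n by apply: leq_trans (dvdn_leq _ (dvdn_gcdr a b)) _.
      apply: wp_seq; apply: (@wp_gcd _ _ _ a b); simpl_state; rewrite ?r4 //; try by lia.
      move=> t3 s3 t3le s3g s3m s3r.
      have r5 : reg s3 5 = r j by rewrite s3r.
      have r4' : reg s3 4 = b by rewrite s3r.
      apply: wp_seq; apply: (@wp_gcd _ _ _ (b %/ gcdn b a) (r j)); simpl_state;
        rewrite ?r4' ?s3g ?r5 //; try by lia.
      * by split; lia.
      * by rewrite gcdnC.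
      * by have := r_le j; lia.
      * by have := r_le j; lia.
      move=> t4 s4 t4le s4g s4m s4r.
      apply: wp_set_reg; simpl_state; rewrite s4g -?rS; first by have := r_le a; lia.
      split; [by lia|by rewrite s4r // s3r //|by rewrite s4r // s3r|split=> /=].
      - move=> i i5; have [e5 e7] : (i == 5) = false /\ (i == 7) = false by lia.
        by simpl_state; rewrite e5 s4r ?s3r /= /update ?e7 ?J1; lia.
      - by rewrite s4m s3m.
      - by simpl_state.
    move/mset_eq0P => aA; apply: wp_skip; split=> //; first by lia.
    split=> //.
      move=> i i5; simpl_state; rewrite ifN ?J1 //; apply/eqP; lia.
    by simpl_state; rewrite J3 /r /As rev_iotaS /= (negbTE aA).
  move=> t2 s2 t2le s2m [J1 J2 J3].
  apply: wp_seq; apply: wp_set_reg; simpl_state; first by lia.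
  pose K j s3 := [/\ forall r, r < 5 -> reg s3 r = if r == 4 then b else reg s1 r,
    mem s3 = mem s1, reg s3 5 = r m & reg s3 6 = gcdn b (r m ^ j)].
  apply: wp_seq; apply: (@wp_for W 7 4 _ b (10 * n + 20) K) => //.
  + by lia.
  + by simpl_state; rewrite J1.
  + split=> //=.
    * by move=> i i5; simpl_state; rewrite ifN 1?ifN ?J1 //; apply/eqP; lia.
    * by simpl_state; rewrite expn0 gcdn1.
  + move=> j s3 jb s3b [K1 K2 K3 K4].
    have tb : gcdn b (r m ^ j) <= b by apply: dvdn_leq (dvdn_gcdl _ _).
    have trn : gcdn b (r m ^ j) * r m <= n * n.
      by apply: leq_mul; apply: leq_trans bn.
    apply: wp_seq; apply: (@wp_gcd _ _ _ b (gcdn b (r m ^ j) * r m)); simpl_state;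
      rewrite ?s3b ?K3 ?K4 //; try by lia.
    * have rmb := r_le m.
      by split; lia.
    move=> t4 s4 t4le s4g s4m s4r.
    have tS : gcdn b (gcdn b (r m ^ j) * r m) = gcdn b (r m ^ j.+1).
      rewrite muln_gcdl -expnSr gcdnA; congr gcdn.
      by apply/gcdn_idPl; rewrite dvdn_mulr.
    apply: wp_set_reg; simpl_state; rewrite s4g tS.
      by apply: leq_trans (dvdn_leq _ (dvdn_gcdl _ _)) _ => //; lia.
    split; [by lia|by rewrite s4r|by rewrite s4r|split=> /=].
    * move=> i i5; have [e6 e7] : (i == 6) = false /\ (i == 7) = false by lia.
      by simpl_state; rewrite e6 s4r /= /update ?e7 ?K1; lia.
    * by rewrite s4m.
    * by rewrite s4r.
    * by [].
  move=> t3 s3 t3le s3b [K1 K2 K3 K4].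
  have eE : gcdn b (r m ^ b) = excess A b.
    rewrite /r excessE //.
      apply: eq_excess => a; rewrite mem_filter mem_rev mem_iota.
      change (a \in enum_mset A) with (a \in A).
      case: (boolP (a \in A)) => //= aA.
      by rewrite (soc_gt0 A a) //= add1n ltnS leq_soc_size.
    by move=> a; rewrite mem_filter => /andP[aA _]; apply: (soc_gt0 A).
  have eb : excess A b <= b by rewrite dvdn_leq // excess_dvd.
  have q1 : reg s3 1 = m by rewrite K1.
  have q2 : reg s3 2 = n by rewrite K1.
  have q4 : reg s3 4 = b by rewrite K1.
  apply: wp_set_mem; simpl_state; rewrite ?q1 ?q2 ?q4 ?K4 ?eE.
  + by do ?split; lia.
  + by lia.
  have tle : t2 + t3 <= n * (30 * n + 70) + 12.
    have : t2 <= n * (20 * n + 30 + 8) + 6 by apply: leq_trans t2le _; rewrite leq_add2r leq_mul2r mn orbT.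
    have : t3 <= n * (10 * n + 20 + 8) + 6 by apply: leq_trans t3le _; rewrite leq_add2r leq_mul2r bn orbT.
    nia.
  split=> //; first by lia.
  split=> /=.
  + by move=> i i4; rewrite K1 ?ifN ?I1 //; [apply/eqP|]; lia.
  + by move=> i im; simpl_state; rewrite ifN ?K2 ?I2 //; apply/eqP; lia.
  + move=> b' /andP[b'0 b'k]; simpl_state; rewrite eqn_add2l; case: eqP => [->//|b'b].
    by rewrite K2 I3 //; lia.
move=> t s' tle s'n [I1 I2 I3]; apply: HQ => //.
by apply: leq_trans tle _; rewrite leq_add2r leq_mul2l; apply/orP; right; lia.
Qed.


(** * The program *)

Lemma size_encode_soc M : size (encode_soc M) = (soc_size M).+1.
Proof. by rewrite /= size_map size_iota. Qed.

Lemma nth_encode_soc M x : 0 < x <= soc_size M -> nth 0 (encode_soc M) x = M x.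
Proof.
case: x => // x /= xN; rewrite (nth_map 0) ?size_iota // nth_iota //.
Qed.

Lemma holds_soc_nth m a M j : holds_soc m a M -> j < (soc_size M).+1 ->
  m (a + j) = nth 0 (encode_soc M) j.
Proof.
case=> m0 mx; case: j => [|j] jN; first by rewrite addn0.
by rewrite nth_encode_soc // mx.
Qed.

Lemma holds_soc_eq m m' a M : holds_soc m a M ->
  (forall i, a <= i <= a + soc_size M -> m' i = m i) -> holds_soc m' a M.
Proof.
case=> m0 mx E; split=> [|x /andP[x0 xM]]; first by rewrite E ?m0 // leqnn leq_addr.
by rewrite E ?mx ?x0 //; lia.
Qed.

Definition quotient_step : cmd :=
  Seq (gcd_cmd (Reg 9) (Reg 4))
 (Seq (SetReg 11 (Reg 20))
      (SetReg 12 (Bin Div (Reg 9) (Reg 20)))).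

Lemma wp_quotient_step W s x q : 0 < x -> x <= W -> q <= W ->
  reg s 9 = x -> reg s 4 = q ->
  wp W quotient_step s (fun t s' => [/\ t <= 10 * x + 20, reg s' 11 = gcdn x q,
     reg s' 12 = x %/ gcdn x q, mem s' = mem s & forall r, r < 11 -> reg s' r = reg s r]).
Proof.
move=> x0 xW qW s9 s4; have gx : gcdn x q <= x by rewrite dvdn_leq // dvdn_gcdl.
have dx : x %/ gcdn x q <= x by apply: leq_div.
apply: wp_seq; apply: (@wp_gcd _ _ _ x q); simpl_state; rewrite ?s9 ?s4 //.
move=> t s1 tle s1g s1m s1r; have r9 : reg s1 9 = x by rewrite s1r.
apply: wp_seq; apply: wp_set_reg; simpl_state; rewrite s1g; first by lia.
apply: wp_set_reg; simpl_state; rewrite ?r9 ?s1g; first by split; lia.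
split=> //; first by lia.
move=> r r11; have [-> ->] : (r == 11) = false /\ (r == 12) = false by lia.
by rewrite s1r //; lia.
Qed.

(** The weight is the indicator of [e = q], expressed by truncated subtraction;
   e is the table entry of the current length. *)
Definition block_step : cmd :=
  let e := Mem (Bin Add (Bin Add (Bin Add (Reg 1) (Reg 2)) (Cst 1)) (Reg 9)) in
  Seq (SetReg 11 (Bin Sub (Cst 1)
         (Bin Add (Bin Sub e (Reg 4)) (Bin Sub (Reg 4) e))))
      (SetReg 12 (Bin Div (Reg 9) (Reg 4))).

Lemma wp_block_step W s x q m n e : 0 < x <= n -> m + n + 1 + n <= W -> q <= n -> e <= n ->
  reg s 9 = x -> reg s 4 = q -> reg s 1 = m -> reg s 2 = n -> mem s (m + n + 1 + x) = e ->
  wp W block_step s (fun t s' => [/\ t <= 30, reg s' 11 = (e == q),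
     reg s' 12 = x %/ q, mem s' = mem s & forall r, r < 11 -> reg s' r = reg s r]).
Proof.
move=> xn nW qn en s9 s4 s1 s2 sm; have dx : x %/ q <= x by apply: leq_div.
apply: wp_seq; apply: wp_set_reg; simpl_state; rewrite ?s9 ?s4 ?s1 ?s2 ?sm.
  by do ?split; lia.
apply: wp_set_reg; simpl_state; rewrite ?s9 ?s4; first by split; lia.
split=> //; first by case: eqP; lia.
by move=> r r11; have [-> ->] : (r == 11) = false /\ (r == 12) = false by lia.
Qed.

(** Registers: 3 is the address of the record, 4 is q, 5 the number of records
   kept.  A record with an empty block is left in place, and the next one
   overwrites it, as register 3 does not move. *)
Definition record_cmd : cmd :=
  Seq (SetMem (Reg 3) (Reg 4))
 (Seq (SetReg 6 (Cst 0))
 (Seq (SetReg 7 (Bin Add (Reg 3) (Cst 1)))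
 (Seq (scatter quotient_step)
 (Seq (SetReg 7 (Bin Add (Bin Add (Reg 7) (Reg 10)) (Cst 1)))
 (Seq (SetReg 6 (Bin Add (Reg 1) (Cst 1)))
 (Seq (scatter block_step)
      (If (Reg 10)
        (Seq (SetReg 3 (Bin Add (Bin Add (Reg 7) (Reg 10)) (Cst 1)))
             (SetReg 5 (Bin Add (Reg 5) (Cst 1))))
        Skip))))))).

Definition record_of (A B : {mset nat}) q := ((quotient A q, block A B q), q).

Definition encode_record (d : {mset nat} * {mset nat} * nat) : seq nat :=
  d.2 :: encode_instance d.1.1 d.1.2.

Lemma size_encode_record A B q : is_soc A ->
  size (encode_record (record_of A B q)) = soc_size A + soc_size (block A B q) + 3.
Proof.
move=> socA; rewrite /encode_record /encode_instance -cat1s 2!size_cat.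
by rewrite !size_encode_soc quotient_size //=; lia.
Qed.

Lemma wp_record W A B s q P K (Q : nat -> state -> Prop) : is_soc A -> is_soc B ->
  let m := soc_size A in let n := soc_size B in
  m <= n -> 0 < q <= n -> reg s 1 = m -> reg s 2 = n -> reg s 3 = P -> reg s 4 = q ->
  reg s 5 = K -> K <= n ->
  holds_soc (mem s) 0 A -> holds_soc (mem s) m.+1 B ->
  (forall b, 0 < b <= n -> mem s (m + n + 1 + b) = excess A b) ->
  m + n + 1 + n < P -> P + m + n + 3 < W ->
  (forall t s', t <= n * (10 * n + 180) + 200 ->
     (forall r, r < 3 -> reg s' r = reg s r) -> reg s' 4 = q ->
     reg s' 3 = P + (if soc_size (block A B q) != 0
                     then size (encode_record (record_of A B q)) else 0) ->
     reg s' 5 = K + (soc_size (block A B q) != 0) ->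
     (forall i, i < P -> mem s' i = mem s i) ->
     (forall j, j < size (encode_record (record_of A B q)) ->
        mem s' (P + j) = nth 0 (encode_record (record_of A B q)) j) ->
     Q t s') ->
  wp W record_cmd s Q.
Proof.
move=> socA socB m n mn qn s1 s2 s3 s4 s5 Kn hA hB hT nP PW HQ.
have q0 : 0 < q by lia.
rewrite size_encode_record // in HQ.
apply: wp_seq; apply: wp_set_mem; simpl_state; rewrite ?s3 ?s4; try by lia.
apply: wp_seq; apply: wp_set_reg; simpl_state; first by lia.
apply: wp_seq; apply: wp_set_reg; simpl_state; rewrite ?s3; first by split; lia.
apply: wp_seq; apply: (@wp_scatter W _ A (gcdn^~ q) (fun a => a %/ gcdn a q) _
  0 (P + 1) (10 * n + 20)) => //.
- apply: holds_soc_eq hA _ => i /andP[_ im]; simpl_state.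
  by rewrite ifN //; apply/eqP; lia.
- by rewrite -/m; lia.
- by rewrite -/m; lia.
- move=> x x0; rewrite dvdn_leq ?dvdn_gcdl // leq_div; split=> //.
  by rewrite mulnC divnK // dvdn_gcdl.
- move=> s' x /andP[x0 xm] s9 sr sm.
  apply: wp_weaken (@wp_quotient_step W s' x q _ _ _ _ _) _ => //; rewrite ?sr //; try by lia.
  by move=> t s'' [tle ? ? ? ?]; split=> //; lia.
move=> t1 u t1le u10 uA ur um.
have uq : soc_size (quotient A q) = m by apply: quotient_size.
have u1 : reg u 1 = m by rewrite ur.
have u2 : reg u 2 = n by rewrite ur.
have u3 : reg u 3 = P by rewrite ur.
have u4 : reg u 4 = q by rewrite ur.
have u5 : reg u 5 = K by rewrite ur.
have u7 : reg u 7 = P + 1 by rewrite ur.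
have umP i : i < P -> mem u i = mem s i.
  by move=> iP; rewrite um /= /update; [rewrite ifN //; apply/eqP|]; lia.
have uP : mem u P = q by rewrite um /= /update ?eqxx //; lia.
rewrite [soc_size (wimage _ _ _)]uq in u10.
apply: wp_seq; apply: wp_set_reg; simpl_state; rewrite ?u7 ?u10.
  by do ?split; lia.
apply: wp_seq; apply: wp_set_reg; simpl_state; rewrite ?u1.
  by do ?split; lia.
apply: wp_seq; apply: (@wp_scatter W _ B (fun b => excess A b == q) (fun b => b %/ q) _
  (m + 1) (P + 1 + m + 1) 30) => //.
- apply: holds_soc_eq (_ : holds_soc (mem s) (m + 1) B) _; first by rewrite addn1.
  by move=> i /andP[_ im]; rewrite /= umP //; lia.
- by rewrite -/n; lia.
- by rewrite -/n; lia.
- move=> x x0; have := leq_div x q.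
  by case: eqP => _ /=; rewrite ?mul1n ?mul0n; split; lia.
- move=> s' x /andP[x0 xn] s9 sr sm; have xn' : x <= n by [].
  have se : mem s' (m + n + 1 + x) = excess A x.
    by rewrite (sm _ _) /= ?(umP _ _) ?(hT x _) ?x0 //; lia.
  apply: (@wp_block_step W s' x q m n (excess A x)) => //; rewrite ?sr //; try by lia.
  by apply: leq_trans xn'; rewrite dvdn_leq // excess_dvd.
move=> t2 v t2le v10 vB vr vm.
have v3 : reg v 3 = P by rewrite vr.
have v5 : reg v 5 = K by rewrite vr.
have v7 : reg v 7 = P + 1 + m + 1 by rewrite vr.
have v4 : reg v 4 = q by rewrite vr.
have vr3 r : r < 3 -> reg v r = reg s r.
  move=> r3; rewrite vr /=; last by lia.
  have [e6 e7] : (r == 6) = false /\ (r == 7) = false by lia.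
  by rewrite /update e6 e7 ur /= /update ?e6 ?e7 //; lia.
have vmP i : i < P -> mem v i = mem s i.
  by move=> iP; rewrite vm /= ?umP //; lia.
have Bn : soc_size (block A B q) <= n.
  by have := @block_sizes A B [:: q] isT; rewrite big_seq1.
have vrec j : j < m + soc_size (block A B q) + 3 ->
    mem v (P + j) = nth 0 (encode_record (record_of A B q)) j.
  case: j => [|j] js.
    by rewrite addn0 vm /= ?uP //; lia.
  rewrite /encode_record /encode_instance -[nth _ (_ :: _) _]/(nth 0 (_ ++ _) j) nth_cat.
  rewrite size_encode_soc [soc_size _]uq; case: ltnP => jm.
    rewrite -(holds_soc_nth _ _ _ _ uA); last by rewrite uq.
    by rewrite vm /=; [congr (mem u _)|]; lia.
  rewrite -(holds_soc_nth _ _ _ _ vB); last by rewrite -/(block A B q); lia.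
  by congr (mem v _); lia.
have t1le' : t1 <= n * (10 * n + 80) + 60.
  apply: leq_trans t1le _; rewrite -/m leq_add2r -addnA.
  by rewrite leq_mul2r mn orbT.
rewrite -/n in t2le.
apply: wp_if; simpl_state; rewrite v10 -/(block A B q).
- by lia.
- move=> sz; apply: wp_seq; apply: wp_set_reg; simpl_state; rewrite ?v7 ?v10 -/(block A B q).
    by do ?split; lia.
  apply: wp_set_reg; simpl_state; rewrite ?v5; first by split; lia.
  apply: HQ => //=; rewrite ?sz ?v5 //.
  + by lia.
  + move=> r r3; have [-> ->] : (r == 5) = false /\ (r == 3) = false by lia.
    exact: vr3.
  + by rewrite -/m; lia.
- move=> sz; apply: wp_skip; apply: HQ => //; rewrite ?sz ?addn0 ?v5 //.
  by lia.
Qed.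


Definition decompose : cmd :=
  Seq (SetReg 1 (Mem (Cst 0)))
 (Seq (SetReg 2 (Mem (Bin Add (Reg 1) (Cst 1))))
 (Seq (SetReg 0 (Bin Add (Reg 1) (Bin Add (Bin Add (Reg 2) (Reg 2)) (Cst 2))))
 (Seq excess_table
 (Seq (SetReg 3 (Bin Add (Reg 0) (Cst 1)))
 (Seq (SetReg 5 (Cst 0))
 (Seq (for_to 4 2 record_cmd)
      (SetMem (Reg 0) (Reg 5)))))))).

Definition excesses (A B : {mset nat}) k : seq nat :=
  [seq q <- iota 1 k | soc_size (block A B q) != 0].

Definition decomposition (A B : {mset nat}) :=
  [seq record_of A B q | q <- excesses A B (soc_size B)].

Lemma excessesS A B k : excesses A B k.+1 =
  excesses A B k ++ (if soc_size (block A B k.+1) != 0 then [:: k.+1] else [::]).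
Proof. by rewrite /excesses -{1}[k.+1]addn1 iotaD filter_cat /= add1n. Qed.

Lemma holds_soc_load A B :
  holds_soc (nth 0 (encode_instance A B)) 0 A /\
  holds_soc (nth 0 (encode_instance A B)) (soc_size A).+1 B.
Proof.
split; split=> [|x xM]; rewrite /encode_instance nth_cat size_encode_soc ?add0n //.
- by rewrite ifT ?nth_encode_soc //; lia.
- by rewrite ltnn subnn.
by rewrite ifN ?addKn ?nth_encode_soc //; lia.
Qed.

(** The records start behind the table, at address |A| + 2|B| + 3, after the cell
   of their number.  A record takes at most |A| + |B| + 3 cells, so all
   addresses are quadratic in |B|. *)
Lemma wp_decompose W A B : is_soc A -> is_soc B -> soc_size A <= soc_size B ->
  9 * ((soc_size B).+2 * (soc_size B).+2) <= W ->
  let n := soc_size B in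
  wp W decompose (load (encode_instance A B)) (fun t s' =>
    t <= n * (n * (40 * n + 250) + 258) + 50 /\
    returns s' (encode_list (decomposition A B))).
Proof.
move=> socA socB mn WE n.
have [hA hB] := holds_soc_load A B.
set m := soc_size A in mn hB.
have nW : 9 * n + 9 <= W by apply: leq_trans WE; rewrite -/n; nia.
have PW k : k < n -> m + n + n + 3 + k * (m + n + 3) + m + n + 3 < W.
  move=> kn; apply: leq_trans WE; rewrite -/n.
  have : k.+1 * (m + n + 3) <= n * (n + n + 3) by apply: leq_mul => //; lia.
  by rewrite mulSn; nia.
have l0 : nth 0 (encode_instance A B) 0 = m by case: hA.
have l1 : nth 0 (encode_instance A B) (m + 1) = n by rewrite addn1; case: hB.
apply: wp_seq; apply: wp_set_reg; simpl_state; rewrite ?l0; first by lia.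
apply: wp_seq; apply: wp_set_reg; simpl_state; rewrite ?l1; first by do ?split; lia.
apply: wp_seq; apply: wp_set_reg; simpl_state; first by do ?split; lia.
apply: wp_seq; apply: (@wp_excess_table W A n) => //.
move=> t1 s1 t1le s1r s1m s1T.
have r0 : reg s1 0 = m + (n + n + 2) by rewrite s1r.
have r1 : reg s1 1 = m by rewrite s1r.
have r2 : reg s1 2 = n by rewrite s1r.
have s1A : holds_soc (mem s1) 0 A.
  by apply: holds_soc_eq hA _ => i im; rewrite s1m //= -/m; lia.
have s1B : holds_soc (mem s1) m.+1 B.
  by apply: holds_soc_eq hB _ => i im; rewrite s1m //= -/m; lia.
apply: wp_seq; apply: wp_set_reg; simpl_state; rewrite ?r0; first by do ?split; lia.
apply: wp_seq; apply: wp_set_reg; simpl_state => //.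
pose out k := flatten [seq encode_record (record_of A B q) | q <- excesses A B k].
have outS k : out k.+1 = out k ++ (if soc_size (block A B k.+1) != 0
    then encode_record (record_of A B k.+1) else [::]).
  by rewrite /out excessesS map_cat flatten_cat; case: ifP; rewrite //= cats0.
have size_out k : size (out k) <= k * (m + n + 3).
  elim: k => // k IH; rewrite outS size_cat mulSn addnC leq_add //.
  have : soc_size (block A B k.+1) <= n.
    by have := @block_sizes A B [:: k.+1] isT; rewrite big_seq1.
  by case: ifP; rewrite ?size_encode_record // -/m; lia.
have size_ex k : size (excesses A B k) <= k.
  by rewrite size_filter (leq_trans (count_size _ _)) ?size_iota.
pose O := m + (n + n + 2).
pose I k s := [/\ [/\ reg s 0 = O, reg s 1 = m & reg s 2 = n],
  reg s 3 = O + 1 + size (out k), reg s 5 = size (excesses A B k),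
  forall i, i < O -> mem s i = mem s1 i &
  forall j, j < size (out k) -> mem s (O + 1 + j) = nth 0 (out k) j].
apply: wp_seq; apply: (@wp_for W 4 2 _ n (n * (10 * n + 180) + 200) I) => //.
- by lia.
- by split=> //=; simpl_state; rewrite ?addn0 //; split.
- move=> k s2 kn s2n [[I0 I1 I2] I3 I5 Im Io].
  have szk := size_out k; have exk := size_ex k; have PWk := PW k kn.
  apply: (@wp_record W A B _ k.+1 (O + 1 + size (out k)) (size (excesses A B k)));
    simpl_state; rewrite -?/m -?/n //; try by rewrite ?/O; lia.
  + by apply: holds_soc_eq s1A _ => i im; rewrite Im // /O -/m; lia.
  + by apply: holds_soc_eq s1B _ => i im; rewrite Im // /O -/m; lia.
  + by move=> b bn; rewrite Im ?s1T // /O; lia.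
  move=> t s' tle s'r s'4 s'3 s'5 s'm s'o; split=> //; first by rewrite s'r.
  split.
  + by rewrite !s'r.
  + by rewrite s'3 outS [in RHS]size_cat addnA; case: ifP.
  + by rewrite s'5 excessesS [in RHS]size_cat; case: ifP.
  + by move=> i iO; rewrite s'm ?Im //; lia.
  move=> j; rewrite outS size_cat nth_cat => js; case: (ltnP j (size (out k))) js => jo js.
    by rewrite s'm ?Io // ltn_add2l.
  case: ifP js => sz; last by rewrite addn0 ltnNge jo.
  move=> js; rewrite -s'o; first by congr (mem s' _); lia.
  by rewrite ltn_subLR.
move=> t s tle sn [[I0 I1 I2] I3 I5 Im Io].
have exn := size_ex n.
apply: wp_set_mem; simpl_state; rewrite ?I0 ?I5 ?/O //; try by lia.
split; first by lia.
move=> j; simpl_state; rewrite I0.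
have outE : flatten [seq d.2 :: encode_instance d.1.1 d.1.2 | d <- decomposition A B] = out n.
  by rewrite /out /decomposition -map_comp.
case: j => [|j] jo; first by rewrite addn0 eqxx /= size_map.
rewrite -[nth 0 _ _]/(nth 0 (flatten _) j) outE ifN; last by apply/eqP; lia.
rewrite -Io; first by congr (mem s _); rewrite /O; lia.
by move: jo; rewrite /encode_list /= outE.
Qed.

Lemma excess_mem_excesses (A B : {mset nat}) b : is_soc B -> b \in B ->
  excess A b \in excesses A B (soc_size B).
Proof.
move=> socB bB; have b0 := soc_gt0 _ _ socB bB.
have eb : excess A b <= b by rewrite dvdn_leq // excess_dvd.
rewrite mem_filter mem_iota excess_gt0 add1n ltnS (leq_trans eb) ?leq_soc_size // andbT -lt0n.
rewrite andbT; have x0 : 0 < b %/ excess A b by rewrite divn_gt0 // excess_gt0.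
apply: (leq_trans x0); apply/leq_soc_size/mem_wimage; exists b.
by rewrite eqxx.
Qed.

Lemma block_neq0 A B q : soc_size (block A B q) != 0 -> exists2 b, b \in B & excess A b = q.
Proof.
have [->|[x xB] _] := mset_0Vmem (block A B q); first by rewrite soc_sizeE big_mset0.
by have [b [bB E _]] := mem_block _ _ _ _ xB; exists b.
Qed.

Theorem lemma2 :
  exists (prog : cmd) (c : nat), forall A B : {mset nat},
    is_instance A B -> consistent A B ->
    exists D : seq ({mset nat} * {mset nat} * nat),
      computes ((soc_size B).+2 ^ c) prog
        (encode_instance A B) (encode_list D) (c * soc_size B ^ 3)
      /\ size D <= soc_size B
      /\ (forall d, d \in D ->
            [/\ is_instance d.1.1 d.1.2, basic d.1.1 d.1.2 & 0 < d.2])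
      /\ (forall d, d \in D -> soc_size d.1.1 = soc_size A)
      /\ (forall d, d \in D ->
            lcm_set (lengths d.1.1) %| lcm_set (lengths A))
      /\ \sum_(d <- D) soc_size d.1.2 <= soc_size B
      /\ Sol A B =
           \big[set_add/[set mset0]%classic]_(d <- D)
             set_scale (Sol d.1.1 d.1.2) d.2.
Proof.
(* The time is at most 598 n^3 for n >= 1, and (n + 2)^4 >= 9 (n + 2)^2. *)
have [c cE] : exists c, c = 1000 by exists 1000.
exists decompose, c => A B inst cons; have [socA socB An0 Bn0] := inst.
have mn := consistent_size _ _ inst cons.
set n := soc_size B in mn *.
have n0 : 0 < n.
  have [//|[b bB]] := mset_0Vmem B.
  exact: leq_trans (soc_gt0 _ _ socB bB) (leq_soc_size _ _ bB).
have uniq_ex : uniq (excesses A B n) by rewrite filter_uniq ?iota_uniq.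
exists (decomposition A B).
split; last (split; last (split; last (split; last (split; last split)))).

- have [|t [s [ex [tle ret]]]] := wp_decompose (n.+2 ^ c) A B socA socB mn.
    apply: leq_trans (_ : n.+2 ^ 4 <= _); last by rewrite leq_exp2l // cE.
    by rewrite -/n !expnS expn0; nia.
  exists t, s; split=> //; apply: leq_trans tle _; rewrite -/n cE !expnS expn0 muln1.
  have h2 : n <= n * n by apply: leq_pmulr.
  have h3 : n * n <= n * (n * n) by apply: leq_pmull.
  by nia.
- by rewrite size_map size_filter (leq_trans (count_size _ _)) ?size_iota.
- move=> d /mapP[q]; rewrite mem_filter => /andP[sq qn] -> /=; split.
  + split; [exact: quotient_soc|exact: block_soc|exact: quotient_neq0|].
    by move=> E; move: sq; rewrite E soc_sizeE big_mset0.
  + exact: block_basic.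
  + by move: qn; rewrite mem_iota => /andP[].
- by move=> d /mapP[q _ ->] /=; apply: quotient_size.
- by move=> d /mapP[q _ ->] /=; apply: quotient_lcm.
- by rewrite big_map block_sizes.
rewrite big_map; apply: Sol_decomposition => //.
  by move=> b; apply: excess_mem_excesses.
by move=> q; rewrite mem_filter => /andP[/block_neq0[b _ E] _]; exists b.
Qed.
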